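(* Let $R$ be a ring with identity and let $U_R$ be a non-zero artinian uniserial right $R$-module with endomorphism ring $S=\mathrm{End}(U_R)$. Let $0=U_0<U_1<\dots<U_\alpha=U$ be the chain of all submodules of $U$, indexed by the ordinals $\le\alpha$, and let $\beta:=\min\{\gamma\mid \gamma\le\alpha,\ U_\gamma=\ker f \text{ for some } f\in S \text{ with } \ker f\neq 0\}$. The following conditions are equivalent: (a) $\beta\omega\ge\alpha$ (ordinal multiplication). (b) For any set $I$, the family $(U_i)_{i\in I}$, where $U_i=U_R$ for every $i\in I$, is locally $T$-nilpotent. Moreover, if any of these two equivalent conditions holds, then $\mathrm{Add}(U)$ is a covering class.
   Context: A module is uniserial if its lattice of submodules is linearly ordered by inclusion; the lattice of submodules of an artinian uniserial module is well ordered, hence isomorphic to $\alpha+1$ for a unique ordinal $\alpha$. A family of modules $\{M_i\mid i\in I\}$ is locally $T$-nilpotent if for each sequence of non-isomorphisms $M_{i_1}\xrightarrow{f_1}M_{i_2}\xrightarrow{f_2}M_{i_3}\xrightarrow{f_3}\cdots$ with indices $i_n\in I$ (repetitions of indices allowed) and each $x\in M_{i_1}$ there exists $m\in\mathbb{N}$ such that $f_mf_{m-1}\cdots f_1(x)=0$. $\mathrm{Add}(U)$ denotes the class of all right $R$-modules isomorphic to a direct summand of a direct sum $U^{(X)}$ of copies of $U$. An $\mathrm{Add}(U)$-precover of a right $R$-module $A$ is a homomorphism $f\colon C\to A$ with $C\in\mathrm{Add}(U)$ such that every homomorphism $C'\to A$ with $C'\in\mathrm{Add}(U)$ factors through $f$;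 it is a cover if moreover every endomorphism $h$ of $C$ with $fh=f$ is an automorphism. $\mathrm{Add}(U)$ is covering if every right $R$-module has an $\mathrm{Add}(U)$-cover. *)

(* Defs.v *)
From HB Require Import structures.
From mathcomp Require Import all_boot all_order all_algebra.
From mathcomp Require Import boolp classical_sets functions cardinality.
Set Implicit Arguments.
Unset Strict Implicit.
Unset Printing Implicit Defensive.
Import GRing.Theory.
Local Open Scope classical_set_scope.
Local Open Scope ring_scope.

(* Ordinals as well-founded trees: [Lsub f] is the least ordinal strictly
   above every [f i].  Two trees denote the same ordinal when each is [<=o]
   the other; every notion below is compatible with that equivalence. *)
Inductive Ord : Type := Lsub (A : Type) (f : A -> Ord).

(* Lsub f <= y  iff  f i < y for all i, and  x < Lsub g  iff  x <= g j for
   some j. *)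
Fixpoint ord_le (x y : Ord) : Prop :=
  match x, y with Lsub A f, Lsub B g => forall i, exists j, ord_le (f i) (g j) end.

Infix "<=o" := ord_le (at level 70, no associativity).

Definition ord0o : Ord := Lsub (fun i : False => match i return Ord with end).

Definition ord_succ (x : Ord) : Ord := Lsub (fun _ : unit => x).

Definition ord_of_nat (n : nat) : Ord := iter n ord_succ ord0o.

Definition ord_omega : Ord := Lsub ord_of_nat.

(* x + y is the least ordinal strictly above all x' < x and all x + y' with
   y' < y. *)
Fixpoint ord_add (x y : Ord) : Ord :=
  match x, y with
  | Lsub A f, Lsub B g => Lsub (fun k : A + B =>
      match k with inl i => f i | inr j => ord_add x (g j) end)
  end.

(* x * y is the least ordinal strictly above all x * y' + x' with y' < y and
   x' < x; thus x * omega is the supremum of x, x + x, x + x + x, etc. *)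
Fixpoint ord_mul (x y : Ord) : Ord :=
  match x, y with
  | Lsub A f, Lsub B g => Lsub (fun p : B * A =>
      ord_add (ord_mul x (g p.1)) (f p.2))
  end.

Infix "*o" := ord_mul (at level 40, left associativity).

Definition is_ord_min (P : Ord -> Prop) (x : Ord) : Prop :=
  P x /\ forall y, P y -> x <=o y.

(* Left modules over the converse ring R^c are the right R-modules, so the
   definitions below apply to right modules. *)

Definition submodule (R : pzRingType) (V : lmodType R) (N : set V) : Prop :=
  submod_closed [in N].

Definition uniserial (R : pzRingType) (V : lmodType R) : Prop :=
  forall N N' : set V, submodule N -> submodule N' -> N `<=` N' \/ N' `<=` N.

Definition artinian (R : pzRingType) (V : lmodType R) : Prop :=
  forall N : nat -> set V, (forall n, submodule (N n)) ->
    (forall n, N n.+1 `<=` N n) ->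
    exists n, forall m, (n <= m)%N -> N m = N n.

Definition ker (R : pzRingType) (V W : lmodType R) (f : {linear V -> W}) : set V :=
  [set x | f x = 0].

(* c is an order isomorphism from the ordinals <= alpha onto the lattice of
   submodules of V; in particular c 0 = 0, c alpha = V, and c is strictly
   increasing. *)
Definition submodule_chain (R : pzRingType) (V : lmodType R)
    (alpha : Ord) (c : Ord -> set V) : Prop :=
  [/\ forall x, x <=o alpha -> submodule (c x),
      forall x y, x <=o alpha -> y <=o alpha -> (x <=o y <-> c x `<=` c y) &
      forall N, submodule N -> exists2 x, x <=o alpha & c x = N].

(* f n \o ... \o f 1 \o f 0 *)
Fixpoint comp_upto (R : pzRingType) (V : nat -> lmodType R)
    (f : forall n, {linear V n -> V n.+1}) (n : nat) : V 0%N -> V n.+1 :=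
  match n with
  | 0%N => f 0%N
  | n'.+1 => fun x => f n'.+1 (comp_upto f n' x)
  end.

Definition locally_T_nilpotent (R : pzRingType) (I : Type)
    (M : I -> lmodType R) : Prop :=
  forall (i : nat -> I) (f : forall n, {linear M (i n) -> M (i n.+1)}),
    (forall n, ~ bijective (f n)) ->
    forall x : M (i 0%N), exists m, comp_upto (V := fun n => M (i n)) f m x = 0.

Section DirectSum.
Variables (X : Type) (R : pzRingType) (V : lmodType R).

Definition finsupport : pred (X -> V) :=
  fun u => `[< finite_set [set x | u x <> 0] >].

Lemma finsupport_submod : submod_closed finsupport.
Proof.
split.
  apply/asboolP; rewrite (_ : [set x | _] = set0) //.
  by apply/seteqP; split => x.
move=> a u v /asboolP fu /asboolP fv; apply/asboolP.
apply: (@sub_finite_set _ _ ([set x | u x <> 0] `|` [set x | v x <> 0])).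
  move=> x /= uv0; apply: contrapT => /not_orP[/contrapT u0 /contrapT v0].
  by apply: uv0; rewrite /GRing.add /= /GRing.scale /= u0 v0 scaler0 addr0.
by rewrite finite_setU.
Qed.

HB.instance Definition _ :=
  GRing.isSubmodClosed.Build R (X -> V) finsupport finsupport_submod.

(* The direct sum V^(X): families of elements of V, indexed by X, with
   finitely many nonzero terms; operations are pointwise. *)
Record dsum : Type := Dsum {dsum_fun :> X -> V; _ : dsum_fun \in finsupport}.

HB.instance Definition _ := [isSub for dsum_fun].
HB.instance Definition _ := [Choice of dsum by <:].
HB.instance Definition _ := [SubChoice_isSubLmodule of dsum by <:].

End DirectSum.
Arguments dsum X {R} V.

Definition direct_summand (R : pzRingType) (V : lmodType R) (N : set V) : Prop :=
  submodule N /\ exists N' : set V,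
    [/\ submodule N', N `&` N' = [set 0] &
        forall v, exists x y, [/\ N x, N' y & v = x + y]].

Definition Add (R : pzRingType) (V : lmodType R) : lmodType R -> Prop :=
  fun C => exists (X : Type) (N : set (dsum X V)), direct_summand N /\
    exists i : {linear C -> dsum X V}, injective i /\ range i = N.

Definition precover (R : pzRingType) (K : lmodType R -> Prop)
    (A C : lmodType R) (f : {linear C -> A}) : Prop :=
  K C /\ forall (C' : lmodType R) (g : {linear C' -> A}), K C' ->
    exists h : {linear C' -> C}, f \o h =1 g.

Definition cover (R : pzRingType) (K : lmodType R -> Prop)
    (A C : lmodType R) (f : {linear C -> A}) : Prop :=
  precover K f /\ forall h : {linear C -> C}, f \o h =1 f -> bijective h.

Definition covering (R : pzRingType) (K : lmodType R -> Prop) : Prop :=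
  forall A : lmodType R, exists (C : lmodType R) (f : {linear C -> A}), cover K f.

(* Main.v *)
Require Import Defs.
From HB Require Import structures.
From mathcomp Require Import all_boot all_order all_algebra.
From mathcomp Require Import boolp classical_sets functions cardinality.
From mathcomp Require Import finmap fsbigop.
Set Implicit Arguments.
Unset Strict Implicit.
Unset Printing Implicit Defensive.
Import GRing.Theory.
Local Open Scope classical_set_scope.
Local Open Scope ring_scope.

(** Write S = End(U).  An injective endomorphism of an artinian module is
    bijective, so the non-isomorphisms in S are the endomorphisms with non-zero
    kernel, called singular below; as U is uniserial they form an ideal, the
    radical of the local ring S.

    (a) <-> (b).  Ranks of submodules are compared with ordinals by rank_ge and
    rank_le, which recurse on the ordinal and do not mention the chain.  Pulling
    a submodule back along a linear map g adds the rank of ker g on the left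
    (rank_ge_preimage, rank_le_preimage).  Every singular kernel has rank at
    least beta, so a product of n singular endomorphisms is zero or has a kernel
    of rank at least beta * n (rad_word_rank_ge); for a singular f whose kernel
    has rank exactly beta, the kernel of the n-th power of f has rank at most
    beta * n (iter_rank_le).  If alpha <= beta * omega, the union of the kernels
    of the powers of f has rank at least beta * omega, hence is U, and comparing
    ranks shows that ker (f ^ n) is killed by every product of n singular
    endomorphisms: each u in U is killed by all long enough products, with a
    length depending on u only (uniformly_nilpotent).  This implies (b).
    Conversely, (b) for the constant sequence f, f, f, and so on, says that U is
    the union of the ker (f ^ n), so that its rank is at most beta * omega.

    Covers.  By uniform nilpotency, an endomorphism k of a direct sum of copies
    of U whose matrix entries are all singular is locally nilpotent, hence 1 - k
    is bijective (one_sub_bijective).  Given A, let H = Hom(U, A), with the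
    evaluation map from U^(H) to A, and let the radical homomorphisms U -> A be
    those that factor through evaluation by a map U -> U^(H) with singular
    entries.  Modulo these, H is a vector space over the division ring of S modulo
    its radical, and a subset Y of H lifting a basis exists by Zorn's lemma.  A
    Nakayama argument based on one_sub_bijective shows that every element of H factors through the
    map f : U^(Y) -> A, so f is a precover.  Independence of Y says that
    f k = 0 forces the entries of k to be singular; if f h = f, applying this to
    k = 1 - h shows that h is bijective, so f is a cover (cover_map). *)

(** * Linear maps and direct sums *)

Lemma submoduleP (R : pzRingType) (V : lmodType R) (N : set V) :
  submodule N <-> N 0 /\ forall a u v, N u -> N v -> N (a *: u + v).
Proof.
split=> [[/set_mem N0 NP]|[N0 NP]]; split=> //; last 2 first.
- exact/mem_set.
- by move=> a u v /set_mem Nu /set_mem Nv; apply/mem_set/NP.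
by move=> a u v /mem_set Nu /mem_set Nv; apply/set_mem/NP.
Qed.

Lemma submoduleT (R : pzRingType) (V : lmodType R) : submodule [set: V].
Proof. exact/submoduleP. Qed.

Lemma submodule0 (R : pzRingType) (V : lmodType R) : submodule [set (0 : V)].
Proof.
by apply/submoduleP; split=> // a _ _ -> -> /=; rewrite scaler0 addr0.
Qed.

(** Turns a function defined by choice, or a composite known only as a function,
    into an element of the type of linear maps. *)
Lemma linear_bundle (R : pzRingType) (V W : lmodType R) (f : V -> W) :
  linear f -> exists g : {linear V -> W}, f = g.
Proof.
move=> lf; pose m := GRing.isLinear.Build R V W *:%R f lf.
by exists (HB.pack_for {linear V -> W} f m).
Qed.

Section DSum.
Variables (R : pzRingType) (X : Type) (V : lmodType R).
Implicit Types (d e : dsum X V) (x y : X).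

Lemma dsumP d e : (forall x, d x = e x) -> d = e.
Proof. by move=> de; apply/val_inj/funext. Qed.

Lemma dsumDZ a d e x : (a *: d + e) x = a *: d x + e x. Proof. by []. Qed.
Lemma dsumD d e x : (d + e) x = d x + e x. Proof. by []. Qed.

Lemma dsum_fin d : finite_set [set x | d x <> 0].
Proof. by case: d => d dP /=; exact/asboolP. Qed.

Definition dinj_fun x (v : V) : X -> V := fun y => if `[< y = x >] then v else 0.

Lemma dinj_finsupport x v : dinj_fun x v \in @finsupport X R V.
Proof.
apply/asboolP; apply: (sub_finite_set _ (finite_set1 x)) => y /=.
by rewrite /dinj_fun; case: asboolP.
Qed.

Definition dinj x (v : V) : dsum X V := Dsum (dinj_finsupport x v).
Lemma dinj_linear x : linear (dinj x).
Proof.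
move=> a u v; apply: dsumP => y; rewrite dsumDZ /= /dinj /= /dinj_fun.
by case: asboolP => // _; rewrite scaler0 addr0.
Qed.
HB.instance Definition _ x :=
  GRing.isLinear.Build R V (dsum X V) *:%R (dinj x) (dinj_linear x).

Lemma dinjE x v y : dinj x v y = if `[< y = x >] then v else 0.
Proof. by []. Qed.

Definition dproj x d : V := d x.
HB.instance Definition _ x :=
  GRing.isLinear.Build R (dsum X V) V *:%R (dproj x) (fun _ _ _ => erefl).

Section Lift.
Variables (W : lmodType R) (phi : X -> {linear V -> W}).

Definition dlift d : W := \sum_(x \in [set: {classic X}]) phi x (d x).

(** Computing the sum over any finite set containing the support lets linearity
    compare two families over a common index set. *)
Lemma dlift_finite (D : set {classic X}) d : finite_set D ->
  [set x | d x <> 0] `<=` D -> dlift d = \sum_(x <- fset_set D) phi x (d x).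
Proof.
move=> Dfin dD; rewrite -fsbig_finite //; apply/esym/fsbig_widen => // x [_ nDx].
have [dx0|dx0] := pselect (d x = 0); last by case: nDx; exact: dD.
by rewrite /preimage /= dx0 linear0.
Qed.

Lemma dlift_linear : linear dlift.
Proof.
move=> a d e; pose D : set {classic X} := [set x | d x <> 0] `|` [set x | e x <> 0].
have Dfin : finite_set D by rewrite finite_setU; split; exact: dsum_fin.
rewrite !(@dlift_finite D) //.
- rewrite scaler_sumr -big_split; apply: eq_bigr => x _.
  exact: linearP.
- by move=> x; right.
- by move=> x; left.
move=> x /= dex0; apply: contrapT => /not_orP[/contrapT dx0 /contrapT ex0].
by apply: dex0; rewrite /GRing.add /= /GRing.scale /= dx0 ex0 scaler0 addr0.
Qed.
HB.instance Definition _ :=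
  GRing.isLinear.Build R (dsum X V) W *:%R dlift dlift_linear.

Lemma dlift_dinj x v : dlift (dinj x v) = phi x v.
Proof.
rewrite (@dlift_finite [set x]) ?fset_set1 ?big_seq_fset1.
- by rewrite dinjE; case: asboolP.
- exact: finite_set1.
by move=> y /=; rewrite /dinj_fun; case: asboolP.
Qed.
End Lift.

Lemma dsum_decomp d : exists s : seq X, d = \sum_(x <- s) dinj x (d x).
Proof.
pose D : set {classic X} := [set x | d x <> 0].
have Dfin : finite_set D by exact: dsum_fin.
exists (fset_set D); apply: dsumP => y.
rewrite -[RHS]/(dproj y _) linear_sum /=.
have [yD|yD] := boolP ((y : {classic X}) \in fset_set D).
  rewrite (bigD1_seq (y : {classic X})) ?finmap.fset_uniq //= big1 => [|x /eqP xy].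
    by rewrite addr0 /dproj /= /dinj_fun; case: asboolP.
  by rewrite /dproj /= /dinj_fun; case: asboolP => // yx; case: xy.
rewrite (@big1_seq _ _ _ {classic X}) => [|x /= xD].
  move: yD; rewrite in_fset_set // => /negP yD.
  by apply: contrapT => dy0; apply: yD; apply/mem_set.
rewrite /dproj /= /dinj_fun; case: asboolP => // yx; move: yD.
by rewrite [y]yx xD.
Qed.

(** The working form of the decomposition of d: properties of psi d that define
    a submodule can be checked on the components of d. *)
Lemma dsum_image (W : lmodType R) (psi : {linear dsum X V -> W}) (Q : set W) d :
  submodule Q -> (forall x, Q (psi (dinj x (d x)))) -> Q (psi d).
Proof.
move=> /submoduleP[Q0 QP] Qd; have [s ->] := dsum_decomp d.
rewrite linear_sum; elim: s => [|x s IHs]; rewrite ?big_nil // big_cons.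
by rewrite -[psi _]scale1r; exact: QP.
Qed.

Lemma dsum_ext (W : lmodType R) (psi chi : {linear dsum X V -> W}) :
  (forall x v, psi (dinj x v) = chi (dinj x v)) -> psi =1 chi.
Proof.
move=> pc d; have [s ->] := dsum_decomp d; rewrite !linear_sum.
by apply: eq_bigr => x _; exact: pc.
Qed.
End DSum.

(** * Ordinals and ranks of submodules *)

Lemma ord_le_refl x : x <=o x.
Proof. by elim: x => A f IH /= i; exists i. Qed.

Lemma ord_le_trans x y z : x <=o y -> y <=o z -> x <=o z.
Proof.
elim: x y z => A f IH [B g] [C h] /= fg gh i.
have [j fgij] := fg i; have [k ghjk] := gh j.
by exists k; exact: IH fgij ghjk.
Qed.

Lemma ord_sub_lt A (f : A -> Ord) y i : Lsub f <=o y -> ord_succ (f i) <=o y.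
Proof. by case: y => B g fg _; exact: fg. Qed.

Lemma ord_lt_irrefl x : ~ ord_succ x <=o x.
Proof.
by elim: x => A f IH /(_ tt)[i fi]; apply: (IH i); exact: ord_sub_lt fi.
Qed.

(** If x <= z fails at some f i, no element below z is at or above f i; the
    induction hypothesis at f i puts all of them strictly below it. *)
Lemma ord_le_total x z : x <=o z \/ ord_succ z <=o x.
Proof.
elim: x z => A f IH [B g].
have [|nfg] := pselect (Lsub f <=o Lsub g); [by left | right => /= _].
move/existsNP: nfg => [i /forallNP fig]; exists i.
case: (f i) (IH i) fig => C h IHi hg k.
by case: (IHi (g k)) => [/hg //|/(_ tt)].
Qed.

Lemma ord_le_sub A (f : A -> Ord) i : f i <=o Lsub f.
Proof.
have : forall x A (f : A -> Ord) i, x = f i -> x <=o Lsub f; last exact.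
elim=> B g IH {}A {}f {}i fi j /=; exists i.
by rewrite -fi; exact: IH.
Qed.

Lemma ord_le_addl x y : x <=o ord_add x y.
Proof.
case: x y => A f [B g] i /=; exists (inl i); exact: ord_le_refl.
Qed.

Lemma ord_mulS_le x n :
  x *o ord_of_nat n.+1 <=o ord_add (x *o ord_of_nat n) x.
Proof.
case: x => A f /=; case: (_ *o _) => B g [u a] /=.
by exists (inr a); exact: ord_le_refl.
Qed.

(** The witness a makes x = Lsub f non-zero: it is needed for the part of
    x * n + x coming from ordinals below x * n, which has to lie below some
    x * n + f a. *)
Lemma ord_mulS_ge A (f : A -> Ord) n (a : A) :
  ord_add (Lsub f *o ord_of_nat n) (Lsub f) <=o Lsub f *o ord_of_nat n.+1.
Proof.
rewrite /=; set y := _ *o _; case: y (ord_le_addl y (f a)) => B g ya /= [b|a'] /=.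
  exists (tt, a); apply: ord_le_trans ya; exact: ord_le_sub.
by exists (tt, a'); exact: ord_le_refl.
Qed.

Section Rank.
Variables (R : pzRingType) (V : lmodType R).
Implicit Types (N : set V) (x y z : Ord).

(** rank_ge y N and rank_le y N bound the ordinal type of the set of proper
    submodules of N from below and from above.  Both recurse on y alone, so
    that ranks of kernels and preimages can be estimated without computing
    their indices in a given chain. *)
Fixpoint rank_ge y N : Prop :=
  match y with Lsub A f => forall i, exists N',
    [/\ submodule N', N' `<` N & rank_ge (f i) N'] end.

Fixpoint rank_le y N : Prop :=
  match y with Lsub A f => forall N',
    submodule N' -> N' `<` N -> exists i, rank_le (f i) N' end.

Lemma rank_ge_le y z N : rank_ge y N -> rank_le z N -> y <=o z.
Proof.
elim: y z N => A f IH [B g] N /= fN gN i.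
have [N' [sN' NN' fN']] := fN i; have [j gN'] := gN _ sN' NN'.
by exists j; exact: IH fN' gN'.
Qed.

Lemma rank_ge_sub y N N' : N `<=` N' -> rank_ge y N -> rank_ge y N'.
Proof.
case: y => A f NN' fN i; have [N0 [sN0 [N0N NN0] fN0]] := fN i.
exists N0; split=> //; split; first exact: subset_trans NN'.
by move=> N'N0; apply: NN0; exact: subset_trans N'N0.
Qed.

Lemma rank_le_sub y N N' : N' `<=` N -> rank_le y N -> rank_le y N'.
Proof.
case: y => A f NN' fN N0 sN0 [N0N' N'N0]; apply: fN => //.
split=> [|NN0]; first exact: subset_trans NN'.
by apply: N'N0; exact: subset_trans NN0.
Qed.

Lemma rank_ge_ord y y' N : y' <=o y -> rank_ge y N -> rank_ge y' N.
Proof.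
elim: y' y N => A f IH [B g] N fg gN i; have [j fgij] := fg i.
by have [N' [sN' NN' gN']] := gN j; exists N'; split=> //; exact: IH gN'.
Qed.

Lemma rank_le_ord y y' N : y <=o y' -> rank_le y N -> rank_le y' N.
Proof.
elim: y y' N => A f IH [B g] N fg fN N' sN' NN'; have [i fN'] := fN _ sN' NN'.
by have [j fgij] := fg i; exists j; exact: IH fgij fN'.
Qed.

(** If N were strictly smaller than N', its rank y would be strictly below a
    lower bound for that of N', contradicting the upper bound y. *)
Lemma rank_subset y N N' : uniserial V -> submodule N -> submodule N' ->
  rank_ge y N -> rank_le y N' -> N' `<=` N.
Proof.
move=> Vu sN sN' yN yN'; have [//|NN'] := Vu _ _ sN' sN.
apply: contrapT => N'N; apply: (@ord_lt_irrefl y).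
by apply: rank_ge_le yN' => /= _; exists N.
Qed.

End Rank.

Lemma submodule_ker (R : pzRingType) (V W : lmodType R) (g : {linear V -> W}) :
  submodule (ker g).
Proof.
apply/submoduleP; split=> [|a u v gu gv]; rewrite /ker /= ?linear0 //.
by rewrite linearP gu gv scaler0 addr0.
Qed.

Section RankPreimage.
Variables (R : pzRingType) (V W : lmodType R) (g : {linear V -> W}).

Lemma submodule_preimage (N : set W) : submodule N -> submodule (g @^-1` N).
Proof.
move=> /submoduleP[N0 NP]; apply/submoduleP.
by rewrite /preimage /= linear0; split=> // a u v gu gv; rewrite linearP; exact: NP.
Qed.

Lemma submodule_image (N : set V) : submodule N -> submodule (g @` N).
Proof.
move=> /submoduleP[N0 NP]; apply/submoduleP; split.
  by exists 0 => //; rewrite linear0.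
move=> a _ _ [u Nu <-] [v Nv <-]; exists (a *: u + v); first exact: NP.
by rewrite linearP.
Qed.

Lemma ker_preimage (N : set W) : submodule N -> ker g `<=` g @^-1` N.
Proof. by move=> /submoduleP[N0 _] u; rewrite /ker /preimage /= => ->. Qed.

(** Submodules of ker g account for y; above ker g, taking preimages is strictly
    increasing on submodules of the image of g, which accounts for z. *)
Lemma rank_ge_preimage y z (N : set W) : submodule N -> N `<=` range g ->
  rank_ge y (ker g) -> rank_ge z N -> rank_ge (ord_add y z) (g @^-1` N).
Proof.
case: y => A f; elim: z N => B h IH N sN Ng fg hN [i|j] /=.
  exact: (rank_ge_sub (ker_preimage sN) fg).
have [N' [sN' [N'N NN'] hN']] := hN j; exists (g @^-1` N'); split.
- exact: submodule_preimage.
- split=> [u|gNN']; first exact: N'N.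
  by apply: NN' => w Nw; have [u _ uw] := Ng _ Nw; move: Nw; rewrite -uw => /gNN'.
by apply: IH => //; exact: subset_trans Ng.
Qed.

(** A proper submodule N' of the preimage either lies strictly inside ker g, or
    contains it and is then the preimage of its image. *)
Lemma rank_le_preimage y z (N : set W) : uniserial V -> submodule N ->
  rank_le y (ker g) -> rank_le z N -> rank_le (ord_add y z) (g @^-1` N).
Proof.
move=> Vu; case: y => A f; elim: z N => B h IH N sN fg hN N' sN' [N'N NN'].
have [gN'|N'g] := pselect (ker g `<=` N'); last first.
  have [//|N'g'] := Vu _ _ (submodule_ker g) sN'.
  by have [i fi] := fg _ sN' (conj N'g' N'g); exists (inl i).
have N'E : N' = g @^-1` (g @` N').
  apply/seteqP; split=> [u N'u|u [v N'v gvu]]; first by exists u.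
  have /submoduleP[_ N'P] := sN'.
  rewrite -[u](subrK v) -[u - v]scale1r; apply: N'P => //; apply: gN'.
  by rewrite /ker /= linearB gvu subrr.
have [||j hj] := hN (g @` N'); first exact: submodule_image.
  split=> [_ [u N'u <-]|NgN']; first exact: N'N.
  by apply: NN' => u Nu; rewrite N'E; exact: NgN'.
exists (inr j); rewrite N'E; apply: IH => //; exact: submodule_image.
Qed.

End RankPreimage.

Section Chain.
Variables (R : pzRingType) (V : lmodType R) (alpha : Ord) (c : Ord -> set V).
Hypothesis V_chain : submodule_chain alpha c.

(** Together with chain_rank_le: the index of a submodule in the chain is its rank. *)
Lemma chain_rank_ge x : x <=o alpha -> rank_ge x (c x).
Proof.
have [c_sub c_le _] := V_chain.
elim: x => A f IH fa i; have fia := ord_le_trans (ord_le_sub f i) fa.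
exists (c (f i)); split; [exact: c_sub| |exact: IH].
split; first by apply/c_le => //; exact: ord_le_sub.
move/(c_le _ _ fa fia) => ffi; apply: (@ord_lt_irrefl (f i)).
exact: ord_sub_lt ffi.
Qed.

Lemma chain_rank_le x : x <=o alpha -> rank_le x (c x).
Proof.
have [c_sub c_le c_surj] := V_chain.
elim: x => A f IH fa N' sN' [N'f fN'].
have [z za cz] := c_surj _ sN'; rewrite -cz in N'f fN' *.
have [/(c_le _ _ fa za)//|/(_ tt)[i zfi]] := ord_le_total (Lsub f) z.
have fia := ord_le_trans (ord_le_sub f i) fa.
by exists i; apply: rank_le_sub (IH i fia); apply/c_le.
Qed.

End Chain.

(** * Singular endomorphisms and nilpotency *)

(** Stated for plain functions, so that it applies to the entries of a map into
    a direct sum without bundling them. *)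
Definition singular (R : pzRingType) (V W : lmodType R) (f : V -> W) : Prop :=
  exists2 u, u <> 0 & f u = 0.

Lemma singularPn (R : pzRingType) (V W : lmodType R) (f : {linear V -> W}) :
  ~ singular f <-> injective f.
Proof.
split=> [nf u v fuv|f_inj [u u0 fu]]; last by apply/u0/f_inj; rewrite fu linear0.
apply: contrapT => uv; apply: nf; exists (u - v).
  by move/eqP; rewrite subr_eq0 => /eqP.
by rewrite linearB fuv subrr.
Qed.

(** The products of n singular endomorphisms. *)
Inductive rad_word (R : pzRingType) (V : lmodType R) : nat -> (V -> V) -> Prop :=
| rad_word0 : rad_word 0 id
| rad_wordS n (f : {linear V -> V}) g :
    singular f -> rad_word n g -> rad_word n.+1 (f \o g).

Lemma rad_word_linear (R : pzRingType) (V : lmodType R) n (g : V -> V) :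
  rad_word n g -> exists h : {linear V -> V}, g = h.
Proof.
elim=> [|{}n f {}g _ _ [h ->]]; apply: linear_bundle => // a u v.
exact: linearP.
Qed.

Lemma rad_word_rcons (R : pzRingType) (V : lmodType R) n (g : V -> V)
    (f : {linear V -> V}) :
  singular f -> rad_word n g -> rad_word n.+1 (g \o f).
Proof.
move=> fs; elim=> [|{}n h {}g hs _ IH]; last exact: rad_wordS hs IH.
exact: rad_wordS fs (rad_word0 V).
Qed.

Lemma rad_word_iter (R : pzRingType) (V : lmodType R) (f : {linear V -> V}) n :
  singular f -> rad_word n (iter n f).
Proof.
by move=> fs; elim: n => [|n]; [exact: rad_word0 | exact: rad_wordS].
Qed.

Lemma iter_linear (R : pzRingType) (U : lmodType R) (f : {linear U -> U}) n :
  exists g : {linear U -> U}, iter n f = g.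
Proof.
elim: n => [|n [g gE]]; apply: linear_bundle => // a u v /=.
by rewrite gE !linearP.
Qed.

Lemma rad_word_comp_upto (R : pzRingType) (V : lmodType R)
    (f : nat -> {linear V -> V}) n :
  (forall i, singular (f i)) -> rad_word n.+1 (comp_upto (V := fun=> V) f n).
Proof.
move=> fs; elim: n => [|n IH]; last exact: (rad_wordS (fs n.+1) IH).
exact: (rad_wordS (fs 0%N) (rad_word0 V)).
Qed.

Lemma comp_upto_const (R : pzRingType) (V : lmodType R) (f : {linear V -> V}) n u :
  comp_upto (V := fun=> V) (fun=> f) n u = iter n.+1 f u.
Proof. by elim: n => //= n ->. Qed.

(** A form of local T-nilpotency in which the length n depends on u but not on
    the product. *)
Definition uniformly_nilpotent (R : pzRingType) (V : lmodType R) : Prop :=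
  forall u : V, exists n, forall g, rad_word n g -> g u = 0.

Section ArtinianUniserial.
Variables (R : pzRingType) (U : lmodType R).
Hypotheses (U_neq0 : exists u : U, u <> 0) (U_artinian : artinian U).
Hypothesis U_uniserial : uniserial U.

(** The images of the powers of f stabilise; cancelling the injective power of f
    in f^n v = f^(n+1) u gives v = f u. *)
Lemma injective_bijective (f : {linear U -> U}) : injective f -> bijective f.
Proof.
move=> f_inj; suff f_surj v : exists u, f u = v.
  have [g fg] := choice f_surj; exists g => // u; exact/f_inj/fg.
have [n|n _ [u _ <-]|n nP] := U_artinian (N := fun n => range (iter n f)).
- have [g ->] := iter_linear f n.
  by apply: submodule_image; exact: submoduleT.
- by exists (f u) => //; rewrite -iterSr.
have : range (iter n f) (iter n f v) by exists v.
rewrite -(nP n.+1) // => -[u _]; rewrite iterSr => fu.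
exists u; elim: n fu {nP} => //= n IH fu; exact/IH/f_inj.
Qed.

Lemma singularP (f : {linear U -> U}) : singular f <-> ~ bijective f.
Proof.
split=> [fs /bij_inj|nf]; first by move/singularPn; exact.
by apply: contrapT => /singularPn/injective_bijective.
Qed.

Section Chain.
Variables (alpha : Ord) (c : Ord -> set U).
Hypothesis U_chain : submodule_chain alpha c.

Lemma chain_top : c alpha = setT.
Proof.
have [_ c_le c_surj] := U_chain.
have [|z za cz] := c_surj setT; first exact/submoduleP.
apply/seteqP; split=> // u _.
by have /c_le : z <=o alpha by []; apply=> //; [exact: ord_le_refl | rewrite cz].
Qed.

Variable beta : Ord.
Hypothesis beta_min : is_ord_min (fun gamma => gamma <=o alpha /\
  exists f : {linear U -> U}, c gamma = ker f /\ ker f <> [set 0]) beta.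

Lemma ker_singular (f : {linear U -> U}) : ker f <> [set 0] <-> singular f.
Proof.
split=> [kf|[u u0 fu] kf]; last by apply: u0; rewrite -[u = 0]/([set 0] u) -kf.
apply: contrapT => fs; apply: kf; apply/seteqP; split=> [u fu|_ ->] /=.
  by apply: contrapT => u0; apply: fs; exists u.
exact: linear0.
Qed.

Lemma minimal_endo : exists f : {linear U -> U},
  [/\ singular f, rank_ge beta (ker f) & rank_le beta (ker f)].
Proof.
have [[ba [f [cf /ker_singular fs]]] _] := beta_min; exists f.
by split=> //; rewrite -cf;
  [exact: chain_rank_ge U_chain _ ba|exact: chain_rank_le U_chain _ ba].
Qed.

Lemma singular_rank_ge (f : {linear U -> U}) : singular f -> rank_ge beta (ker f).
Proof.
move=> fs; have [_ _ c_surj] := U_chain.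
have [z za cz] := c_surj _ (submodule_ker f).
have [_ /(_ z) bz] := beta_min; rewrite -cz.
apply: rank_ge_ord (chain_rank_ge U_chain za); apply: bz.
by split=> //; exists f; split=> //; exact/ker_singular.
Qed.

(** The kernel of f o g is the preimage of ker f under g.  By uniseriality either
    the image of g lies in ker f, and the product vanishes, or it contains ker f,
    and the rank of ker f is added to that of ker g. *)
Lemma rad_word_rank_ge n (g : U -> U) : rad_word n g ->
  (forall u, g u = 0) \/ rank_ge (beta *o ord_of_nat n) [set u | g u = 0].
Proof.
elim=> [|{}n f {}g fs gw]; first by right; case: (beta) => A h /= [[]].
have [h ->] := rad_word_linear gw => -[h0|hn].
  by left=> u /=; rewrite h0 linear0.
have sh : submodule (range h) by apply: submodule_image; exact: submoduleT.
have [hf|fh] := U_uniserial sh (submodule_ker f).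
  by left=> u /=; apply: hf; exists u.
right; rewrite (_ : [set _ | _] = h @^-1` ker f) //.
apply: rank_ge_ord (ord_mulS_le _ _) _.
exact: rank_ge_preimage (submodule_ker f) fh hn (singular_rank_ge fs).
Qed.

Lemma iter_rank_le (f : {linear U -> U}) n :
  singular f -> rank_le beta (ker f) ->
  rank_le (beta *o ord_of_nat n) [set u | iter n f u = 0].
Proof.
(* beta is non-zero, since 0 is a proper submodule of ker f *)
move=> fs fb; have [A [h [a bE]]] : exists A (h : A -> Ord) (a : A), beta = Lsub h.
  have := rank_ge_le (singular_rank_ge fs) fb.
  move: fb; case: (beta) => A h fb _; exists A, h.
  have [u u0 fu] := fs.
  have [||a _] := fb [set 0]; last by exists a.
    exact: submodule0.
  split=> [_ ->|/(_ u fu)//]; exact: linear0.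
elim: n => [|n IH].
  rewrite bE /= => N sN [N0 N0']; exfalso; apply: N0' => u /= ->.
  by have /submoduleP[] := sN.
rewrite bE; apply: rank_le_ord (ord_mulS_ge _ _ a) _; rewrite -bE.
have [g gE] := iter_linear f n.
rewrite (_ : [set _ | _] = g @^-1` ker f); last first.
  by apply/funext => u; rewrite /= gE.
apply: rank_le_preimage (submodule_ker f) _ fb => //.
by move: IH; rewrite gE.
Qed.

(** For a singular f with kernel of rank beta, the union K of the kernels of its
    powers has rank at least beta * omega >= alpha, so K = U.  An element of
    ker (f ^ n), which has rank at most beta * n, is then killed by every product
    of n singular endomorphisms. *)
Theorem uniformly_nilpotent_of_le :
  alpha <=o beta *o ord_omega -> uniformly_nilpotent U.
Proof.
move=> ab; have [f [fs _ fb]] := minimal_endo.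
have fn u : exists n, iter n f u = 0.
  apply: contrapT => /forallNP fu.
  pose K := [set v | exists n, iter n f v = 0].
  have sK n : submodule [set v | iter n f v = 0].
    by have [g ->] := iter_linear f n; exact: submodule_ker.
  have mK n m v : iter n f v = 0 -> iter (m + n) f v = 0.
    by rewrite iterD => ->; elim: m => //= m ->; rewrite linear0.
  have K_sub : submodule K.
    apply/submoduleP; split=> [|a v w [n vn] [m wm]]; first by exists 0%N.
    exists (n + m)%N; have /submoduleP[_] := sK (n + m)%N; apply=> /=.
      by rewrite addnC; exact: mK.
    exact: mK.
  suff Kb : rank_ge (beta *o ord_omega) K.
    have aT : rank_le alpha [set: U].
      by rewrite -chain_top; exact: chain_rank_le U_chain _ (ord_le_refl _).
    have KT := rank_subset U_uniserial K_sub (@submoduleT _ _) (rank_ge_ord ab Kb) aT.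
    have [n] := KT u I.
    exact: fu.
  (* f ^ n is non-zero, as it does not kill u *)
  have kb n : rank_ge (beta *o ord_of_nat n) [set v | iter n f v = 0].
    by case: (rad_word_rank_ge (rad_word_iter n fs)) => // /(_ u)/fu.
  move: kb; case: (beta) => A h kb [n a] /=.
  (* beta * n + h a lies below beta * n.+1, hence is the rank of a proper
     submodule of ker (f ^ n.+1) *)
  have [N [sN [NK KN] Nb]] := kb n.+1 (tt, a); exists N; split=> //.
  split=> [v /NK|KN']; first by exists n.+1.
  by apply: KN => v vn; apply: KN'; exists n.+1.
move=> u; have [n fnu] := fn u; exists n => g gw.
have [h hE] := rad_word_linear gw; rewrite hE in gw *.
have [//|hb] := rad_word_rank_ge gw.
have [k kE] := iter_linear f n.
have := iter_rank_le n fs fb; rewrite kE => kb.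
by apply: (rank_subset U_uniserial (submodule_ker h) (submodule_ker k) hb kb);
  rewrite /ker /= -kE.
Qed.

Theorem locally_T_nilpotent_of_uniform (I : Type) :
  uniformly_nilpotent U -> locally_T_nilpotent (fun _ : I => U).
Proof.
move=> Un i f fnb u; have [n nP] := Un u; exists n.
have := rad_word_comp_upto n (fun k => (singularP (f k)).2 (fnb k)).
move E : (comp_upto _ _) => g; move m : n.+1 => m' gw.
case: gw m E => // k s h ss hw [nk] _ /=; rewrite -nk in hw.
by rewrite (nP _ hw) linear0.
Qed.

(** Nilpotency of the constant sequence f puts an element outside a given proper
    submodule N into some ker (f ^ n.+1); this kernel then strictly contains N,
    so that the rank of N is below beta * n.+1. *)
Theorem le_of_locally_T_nilpotent :
  locally_T_nilpotent (fun _ : unit => U) -> alpha <=o beta *o ord_omega.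
Proof.
have [f [fs _ fb]] := minimal_endo.
move=> /(_ (fun=> tt) (fun=> f) (fun=> (singularP f).1 fs)) Unil.
have := chain_rank_ge U_chain (ord_le_refl alpha); rewrite chain_top.
have fn n := iter_rank_le n fs fb; move: fn.
case: (beta) => B b fn; case: (alpha) => A h hT i; have [N [sN [_ NT] hN]] := hT i.
have /existsNP[u Nu] : ~ forall u, N u by move=> NN; apply: NT => u _.
have [n] := Unil u; rewrite comp_upto_const => fnu.
have [|[t a] Na] := fn n.+1 N sN.
  have [g gE] := iter_linear f n.+1; rewrite gE in fnu *.
  split=> [|gN]; last exact/Nu/gN.
  by case: (U_uniserial sN (submodule_ker g)) => // /(_ u fnu).
by exists (n, a); exact: rank_ge_le hN Na.
Qed.

End Chain.
End ArtinianUniserial.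

(** * Locally nilpotent endomorphisms of direct sums *)

Section LocallyNilpotent.
Variables (R : pzRingType) (U : lmodType R).

Definition rad_torsion n : set U := [set u | forall g, rad_word n g -> g u = 0].

Lemma rad_torsion_submodule n : submodule (rad_torsion n).
Proof.
apply/submoduleP; split=> [g /rad_word_linear[h ->]|a u v un vn g gw].
  exact: linear0.
have [h hE] := rad_word_linear gw; rewrite hE linearP -hE.
by rewrite un // vn // scaler0 addr0.
Qed.

Lemma rad_torsion_leq n m : (n <= m)%N -> rad_torsion n `<=` rad_torsion m.
Proof.
move=> nm u un; rewrite -(subnK nm); elim: (m - n)%N => //= l IH g.
rewrite addSn; move E : (l + n).+1 => i gw.
case: gw E => // j f h _ hw [lE]; rewrite lE in IH.
by rewrite /= (IH _ hw) linear0.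
Qed.

Variables (X : Type) (k : {linear dsum X U -> dsum X U}).
Hypothesis k_rad : forall x y, singular (fun u => k (dinj x u) y).

(** Each application of k lowers by one the length of the products needed to
    kill the components, since an entry of k can be absorbed as a last factor. *)
Lemma iter_rad_torsion n (d : dsum X U) :
  (forall x, rad_torsion n (d x)) -> iter n k d = 0.
Proof.
elim: n d => [|n IH] d dn.
  by apply: dsumP => x; apply: (dn x id); exact: rad_word0.
rewrite iterSr; apply: IH => y.
rewrite -[k d y]/((dproj y \o k) d).
apply: dsum_image (rad_torsion_submodule n) _ => x g gw.
pose s : {linear U -> U} := dproj y \o k \o dinj x.
exact: (dn x _ (rad_word_rcons (f := s) (k_rad x y) gw)).
Qed.

Hypothesis U_nil : uniformly_nilpotent U.

Lemma dsum_rad_torsion (d : dsum X U) : exists n, forall x, rad_torsion n (d x).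
Proof.
have [s ->] := dsum_decomp d; elim: s => [|x s [n nP]].
  by exists 0%N => x; rewrite big_nil; have /submoduleP[] := rad_torsion_submodule 0.
have [m mP] := U_nil (d x); exists (m + n)%N => y; rewrite big_cons.
have /submoduleP[M0 MP] := rad_torsion_submodule (m + n).
rewrite dsumD -[X in X + _]scale1r; apply: MP.
  rewrite dinjE; case: asboolP => // _.
  exact: (rad_torsion_leq (leq_addr _ _) mP).
exact: (rad_torsion_leq (leq_addl _ _) (nP y)).
Qed.

(** The inverse is the geometric series of k, a finite sum on each element. *)
Lemma one_sub_bijective : bijective (fun d => d - k d).
Proof.
have k_nil d : exists n, iter n k d = 0.
  by have [n nP] := dsum_rad_torsion d; exists n; exact: iter_rad_torsion.
pose one_sub : {linear dsum X U -> dsum X U} := idfun \- k.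
have inj : injective one_sub.
  apply/singularPn => -[d d0] /eqP; rewrite subr_eq0 => /eqP /= dk.
  have [n dn] := k_nil d; apply: d0; rewrite -dn.
  by elim: n {dn} => //= n <-.
have surj d : exists e, one_sub e = d.
  have [n dn] := k_nil d; exists (\sum_(i < n) iter i k d).
  suff -> : one_sub (\sum_(i < n) iter i k d) = d - iter n k d by rewrite dn subr0.
  elim: n {dn} => [|n IH]; first by rewrite big_ord0 linear0 subrr.
  by rewrite big_ord_recr linearD IH /= addrA subrK.
have [g gP] := choice surj; exists g => [d|d]; last exact: gP.
exact/inj/gP.
Qed.
End LocallyNilpotent.

(** * Independent families of homomorphisms *)

Section Covers.
Variables (R : pzRingType) (U : lmodType R).
Hypotheses (U_neq0 : exists u : U, u <> 0) (U_artinian : artinian U).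
Hypothesis U_uniserial : uniserial U.

Lemma singularB (V : lmodType R) (f g : {linear U -> V}) :
  singular f -> singular g -> singular (f \- g).
Proof.
move=> [u u0 fu] [v v0 gv].
have [fg|gf] := U_uniserial (submodule_ker f) (submodule_ker g).
  by exists u => //=; rewrite fu (fg u fu) subrr.
by exists v => //=; rewrite gv (gf v gv) subrr.
Qed.

(** If s is injective it is bijective, and a vector killed by f has a preimage. *)
Lemma singular_compr (V : lmodType R) (f : {linear U -> V}) (s : {linear U -> U}) :
  singular f -> singular (f \o s).
Proof.
move=> [u u0 fu]; have [[v v0 sv]|/singularPn s_inj] := pselect (singular s).
  by exists v => //=; rewrite sv linear0.
have [t st ts] := injective_bijective U_artinian s_inj.
exists (t u); last by rewrite /= ts.
by move=> tu; apply: u0; rewrite -[u]ts tu linear0.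
Qed.

(** All entries of h lie in the radical of End(U); such maps need not have
    finitely many non-zero entries, since U need not be finitely generated. *)
Definition radical_map (X : Type) (h : U -> dsum X U) : Prop :=
  forall x, singular (fun u => h u x).

Lemma radical_mapB X (h k : {linear U -> dsum X U}) :
  radical_map h -> radical_map k -> radical_map (h \- k).
Proof.
move=> hr kr x.
exact: (singularB (f := dproj x \o h) (g := dproj x \o k) (hr x) (kr x)).
Qed.

Lemma radical_map_comp X (h : {linear U -> dsum X U}) (s : {linear U -> U}) :
  radical_map h -> radical_map (h \o s).
Proof. by move=> hr x; exact: (singular_compr (f := dproj x \o h) s (hr x)). Qed.

Section Mask.
Variables (X : Type) (Y : set X).

(** The projection of U^(X) onto the summand U^(Y), as an endomorphism. *)
Definition mask_fun (d : dsum X U) : X -> U :=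
  fun x => if `[< Y x >] then d x else 0.

Lemma mask_finsupport d : mask_fun d \in @finsupport X R U.
Proof.
apply/asboolP; apply: (sub_finite_set _ (dsum_fin d)) => x /=.
by rewrite /mask_fun; case: asboolP.
Qed.

Definition mask d : dsum X U := Dsum (mask_finsupport d).

Lemma mask_linear : linear mask.
Proof.
move=> a d e; apply: dsumP => x; rewrite dsumDZ /= /mask_fun.
by case: asboolP => // _; rewrite scaler0 addr0.
Qed.
HB.instance Definition _ :=
  GRing.isLinear.Build R (dsum X U) (dsum X U) *:%R mask mask_linear.

Lemma maskE d x : mask d x = if `[< Y x >] then d x else 0.
Proof. by []. Qed.
End Mask.

Variable A : lmodType R.

(** The canonical map from U^(H) to A, where H = Hom(U, A). *)
Definition evaluation : dsum {linear U -> A} U -> A :=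
  dlift (fun g : {linear U -> A} => g).
HB.instance Definition _ := GRing.Linear.on evaluation.

Lemma evaluation_dinj (g : {linear U -> A}) u : evaluation (dinj g u) = g u.
Proof. exact: dlift_dinj. Qed.

(** The analogue of the subspace H * J of H, where J is the radical of End(U),
    with locally finite sums in place of finite ones. *)
Definition rad_hom (g : U -> A) : Prop :=
  exists h : {linear U -> dsum {linear U -> A} U},
    radical_map h /\ g =1 evaluation \o h.

Lemma rad_homB f g : rad_hom f -> rad_hom g -> rad_hom (f \- g).
Proof.
move=> [h [hr fh]] [k [kr gk]]; exists (h \- k); split; first exact: radical_mapB.
by move=> u /=; rewrite linearB fh gk.
Qed.

Lemma rad_hom_comp g (s : {linear U -> U}) : rad_hom g -> rad_hom (g \o s).
Proof.
move=> [h [hr gh]]; exists (h \o s); split; first exact: radical_map_comp.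
by move=> u /=; rewrite gh.
Qed.

Lemma rad_hom_ext f g : f =1 g -> rad_hom f -> rad_hom g.
Proof. by move=> /funext ->. Qed.

Definition supported_in X (Y : set X) (h : U -> dsum X U) : Prop :=
  forall u x, ~ Y x -> h u x = 0.

(** Linear independence of Y modulo the radical homomorphisms, over the division
    ring End(U) / J: a combination of elements of Y that is a radical
    homomorphism has all its coefficients in J. *)
Definition independent (Y : set {linear U -> A}) : Prop :=
  forall h : {linear U -> dsum {linear U -> A} U},
    supported_in Y h -> rad_hom (evaluation \o h) -> radical_map h.

Lemma chain_bound T (F : set (set T)) (s : seq {classic T}) :
  total_on F subset -> F !=set0 ->
  exists2 Y, F Y & forall x, x \in s -> (\bigcup_(Z in F) Z) x -> Y x.
Proof.
move=> Ftot [Z0 FZ0]; elim: s => [|x s [Y FY sY]]; first by exists Z0.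
have [[Z FZ Zx]|nFx] := pselect ((\bigcup_(Z in F) Z) x); last first.
  by exists Y => // y; rewrite inE => /orP[/eqP -> /nFx|/sY yY /yY].
have [YZ|ZY] := Ftot Y Z FY FZ.
  by exists Z => // y; rewrite inE => /orP[/eqP -> //|/sY yY /yY /YZ].
by exists Y => // y; rewrite inE => /orP[/eqP -> _|/sY yY /yY//]; exact: ZY.
Qed.

(** A non-singular entry of h is injective, hence non-zero at a fixed u0 <> 0, so
    h has only finitely many such entries.  Their indices lie in one member Y of
    the chain; the part of h outside Y is radical, and Y controls the rest. *)
Lemma independent_bigcup (F : set (set {linear U -> A})) :
  F `<=` independent -> total_on F subset -> independent (\bigcup_(Y in F) Y).
Proof.
move=> Find Ftot h hF h_rad g; apply: contrapT => hg.
have [u0 u0_neq0] := U_neq0.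
have FN0 : F !=set0.
  apply: contrapT => F0; apply: hg; exists u0 => //; apply: hF => -[Z FZ _].
  by apply: F0; exists Z.
have hT (y : {linear U -> A}) : h u0 y = 0 -> singular (fun u => h u y).
  by move=> hy; exists u0.
have /(@finite_seqP {classic {linear U -> A}})[s sE] := dsum_fin (h u0).
have [Y FY sY] := chain_bound s Ftot FN0.
(* outside Y the entry of h vanishes at u0, or is indexed outside the union *)
have hY y : ~ Y y -> singular (fun u => h u y).
  move=> nYy; have [hy|hy] := pselect (h u0 y = 0); first by exists u0.
  exists u0 => //; apply: hF => Fy; apply/nYy/sY => //.
  by have : [set` s] y by rewrite -sE.
have rY : radical_map (h \- (mask Y \o h)).
  move=> y; have sub_y u : (h \- (mask Y \o h)) u y = h u y - mask Y (h u) y.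
    exact: (linearB (dproj y)).
  have [Yy|nYy] := pselect (Y y).
    by exists u0 => //; rewrite sub_y maskE asboolT // subrr.
  have [u u_neq0 hu] := hY y nYy.
  by exists u => //; rewrite sub_y maskE asboolF // subr0.
have mY : radical_map (mask Y \o h).
  apply: (Find Y FY) => [u x nYx|].
    by rewrite -[LHS]/(mask Y (h u) x) maskE asboolF.
  apply: rad_hom_ext (rad_homB h_rad (ex_intro _ _ (conj rY (frefl _)))) => u /=.
  by rewrite linearB subKr.
apply: hg; have [Yg|] := pselect (Y g); last exact: hY.
by have [u u_neq0 mu] := mY g; exists u;
  rewrite // -mu -[RHS]/(mask Y (h u) g) maskE asboolT.
Qed.

Lemma rad_hom0 : rad_hom (fun=> 0).
Proof.
exists \0; split=> [g|u]; last by rewrite /= linear0.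
by have [u u_neq0] := U_neq0; exists u.
Qed.

Lemma rad_hom_singular (g : {linear U -> A}) (s : {linear U -> U}) :
  singular s -> rad_hom (g \o s).
Proof.
move=> [u u_neq0 su]; exists (dinj g \o s); split=> [y|v /=].
  by exists u => //=; rewrite su /dinj_fun; case: ifP.
by rewrite evaluation_dinj.
Qed.

(** Otherwise Y together with g is dependent, through some h.  If the entry of h
    at g is singular, dropping it contradicts the independence of Y; if not, it
    is invertible and g can be solved for. *)
Lemma maximal_independent_spans (Y : set {linear U -> A}) (g : {linear U -> A}) :
  independent Y -> (forall Z, Y `<` Z -> ~ independent Z) ->
  exists h : {linear U -> dsum {linear U -> A} U},
    supported_in Y h /\ rad_hom (g \- (evaluation \o h)).
Proof.
move=> Yind Ymax; have [Yg|nYg] := pselect (Y g).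
  exists (dinj g); split=> [u y nYy|].
    by rewrite dinjE; case: asboolP => // yg; rewrite yg in nYy.
  by apply: rad_hom_ext rad_hom0 => u /=; rewrite evaluation_dinj subrr.
have /Ymax/existsNP[h /not_implyP[hY /not_implyP[h_rad /existsNP[x hx]]]] :
    Y `<` Y `|` [set g].
  by split=> [y|YgY]; [left | apply/nYg/YgY; right].
pose s : {linear U -> U} := dproj g \o h.
pose h' : {linear U -> dsum {linear U -> A} U} := h \- (dinj g \o s).
have h'E u y : h' u y = h u y - dinj g (h u g) y by exact: (linearB (dproj y)).
have h'Y : supported_in Y h'.
  move=> u y nYy; rewrite h'E dinjE; case: asboolP => [->|yg].
    by rewrite subrr.
  by rewrite hY ?subr0 // => -[|].
have evh' u : evaluation (h' u) = evaluation (h u) - g (s u).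
  by rewrite -(evaluation_dinj g) -linearB.
have [ss|/singularPn s_inj] := pselect (singular s).
  exfalso; apply: hx; have : radical_map h'.
    apply: Yind => //; apply: rad_hom_ext (rad_homB h_rad (rad_hom_singular g ss)).
    by move=> u; exact: esym (evh' u).
  move=> /(_ x)[u u_neq0]; rewrite h'E dinjE; case: asboolP => [-> _|_].
    exact: ss.
  by rewrite subr0; exists u.
have [t st ts] := injective_bijective U_artinian s_inj.
have [t' tE] := linear_bundle (can2_linear st ts); rewrite tE in ts.
exists (\0 \- (h' \o t')); split=> [u y nYy|].
  have -> : (\0 \- (h' \o t')) u y = 0 - h' (t' u) y.
    exact: (linearB (dproj y)).
  by rewrite h'Y // subr0.
apply: rad_hom_ext (rad_hom_comp t' h_rad) => u.
transitivity (g u - (0 - evaluation (h' (t' u)))).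
  by rewrite evh' ts /= sub0r opprK addrC subrK.
congr (g u - _); by rewrite -[in LHS](linear0 evaluation) -linearB.
Qed.

Hypothesis U_nil : uniformly_nilpotent U.

(** The Nakayama argument.  Splitting each element of H into a combination p of
    elements of Y and a radical part q gives evaluation = evaluation p +
    evaluation q on U^(H), thus evaluation (1 - q) = evaluation p; and 1 - q is
    bijective. *)
Lemma independent_generating : exists Y : set {linear U -> A}, independent Y /\
  forall g : {linear U -> A}, exists h : {linear U -> dsum {linear U -> A} U},
    supported_in Y h /\ evaluation \o h =1 g.
Proof.
have [Y [Yind Ymax]] := Zorn_bigcup independent_bigcup; exists Y; split=> // g.
have [p pP] := choice (fun g' => maximal_independent_spans g' Yind Ymax).
have [q qP] := choice (fun g' => (pP g').2).
have ev_split : evaluation =1 (evaluation \o dlift p) \+ (evaluation \o dlift q).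
  apply: dsum_ext => g' u; rewrite /= !dlift_dinj evaluation_dinj.
  by have [_ /(_ u) /= <-] := qP g'; rewrite [RHS]addrC subrK.
have ev_one_sub d : evaluation (d - dlift q d) = evaluation (dlift p d).
  by rewrite linearB [X in X - _]ev_split /= addrK.
have [] := @one_sub_bijective _ _ _ (dlift q) _ U_nil.
  by move=> g' y; have [/(_ y)[u u_neq0 qu] _] := qP g';
    exists u => //=; rewrite dlift_dinj.
pose one_sub : {linear dsum {linear U -> A} U -> dsum {linear U -> A} U} :=
  idfun \- dlift q.
move=> r r_left r_right.
have [r' rE] := linear_bundle (@can2_linear _ _ _ one_sub r r_left r_right).
exists (dlift p \o r' \o dinj g); split=> [u y nYy|u].
  apply: (dsum_image (psi := dproj y \o dlift p) (submodule0 _)) => g' /=.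
  by rewrite dlift_dinj; exact: (pP g').1.
rewrite -(evaluation_dinj g) -[in RHS](r_right (dinj g u)) rE.
exact: esym (ev_one_sub _).
Qed.

(** The map is evaluation restricted to the summand indexed by an independent
    generating Y.  Independence makes the entries of 1 - h singular whenever
    f h = f. *)
Lemma cover_map : exists (X : Type) (f : {linear dsum X U -> A}),
  (forall g : {linear U -> A}, exists h : {linear U -> dsum X U}, f \o h =1 g) /\
  forall h : {linear dsum X U -> dsum X U}, f \o h =1 f -> bijective h.
Proof.
have [Y [Yind Ygen]] := independent_generating.
pose X := {g | Y g}.
pose f : {linear dsum X U -> A} := dlift (fun x : X => sval x).
pose res : {linear dsum {linear U -> A} U -> dsum X U} :=
  dlift (fun g => match pselect (Y g) with
    left Yg => dinj (exist _ g Yg) : {linear U -> dsum X U} | right _ => \0 end).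
pose ext : {linear dsum X U -> dsum {linear U -> A} U} :=
  dlift (fun x : X => dinj (sval x)).
exists X, f; split=> [g|h fh].
  have [h [hY hg]] := Ygen g; exists (res \o h) => u; rewrite -hg /=.
  apply/eqP; rewrite -subr_eq0; apply/eqP.
  apply: (dsum_image (psi := (f \o res) \- evaluation) (submodule0 _)) => x /=.
  rewrite evaluation_dinj dlift_dinj; case: pselect => [Yx|nYx] /=.
    by rewrite dlift_dinj; exact: subrr.
  by rewrite hY // !linear0 addr0.
have fE : evaluation \o ext =1 f.
  by apply: dsum_ext => x v; rewrite /= !dlift_dinj evaluation_dinj.
have extE x : dproj (sval x) \o ext =1 dproj x.
  apply: dsum_ext => y v; rewrite /= dlift_dinj /dproj /= /dinj_fun.
  have [->|xy] := pselect (x = y); first by rewrite !asboolT.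
  rewrite !asboolF // => sxy; apply: xy; move: sxy.
  by case: x y => [g Yg] [g' Yg'] /= gg'; exact: eq_exist.
pose k : {linear dsum X U -> dsum X U} := idfun \- h.
have k_rad x y : singular (fun u => k (dinj x u) y).
  suff /(_ (sval y))[u u_neq0 ku] : radical_map (ext \o k \o dinj x).
    by exists u => //; rewrite -ku; exact: (esym (extE y (k (dinj x u)))).
  apply: Yind => [u g nYg|].
    apply: (dsum_image (psi := dproj g \o ext) (submodule0 _)) => z /=.
    rewrite dlift_dinj /dproj /= /dinj_fun; case: asboolP => // gz.
    by case: nYg; rewrite gz; exact: svalP.
  apply: rad_hom_ext rad_hom0 => u.
  rewrite -[RHS]/((evaluation \o ext) (k (dinj x u))) fE /k /= linearB.
  by rewrite [f (h _)]fh subrr.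
apply: eq_bij (one_sub_bijective k_rad U_nil) _ _ => d.
by rewrite /= subKr.
Qed.

End Covers.

(** * Covering classes *)

(** The component of v in the range of i is unique, because the complement N'
    meets the range in 0 only. *)
Lemma summand_retraction (R : pzRingType) (C D : lmodType R) (i : {linear C -> D}) :
  injective i -> direct_summand (range i) ->
  exists p : {linear D -> C}, cancel i p.
Proof.
move=> i_inj [_ [N' [sN' iN' iDN']]].
have /choice[p pP] v : exists c, N' (v - i c).
  have [_ [y [[c _ <-] N'y ->]]] := iDN' v.
  by exists c; rewrite addrC addKr.
have /submoduleP[N'0 N'P] := sN'.
have p_uniq v c : N' (v - i c) -> p v = c.
  move=> N'c; apply/i_inj/eqP; rewrite -subr_eq0; apply/eqP.
  have : (range i `&` N') (i (p v - c)).
    split; first by exists (p v - c).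
    have -> : i (p v - c) = (-1) *: (v - i (p v)) + (v - i c).
      by rewrite linearB scaleN1r opprB addrA subrK.
    exact: N'P.
  by rewrite iN' linearB.
have p_lin : linear p.
  move=> a u v; apply: p_uniq; rewrite linearP opprD addrACA -scalerBr.
  exact: N'P.
have [q qE] := linear_bundle p_lin.
by exists q => c; rewrite -qE; apply: p_uniq; rewrite subrr.
Qed.

Theorem covering_of_uniformly_nilpotent (R : pzRingType) (U : lmodType R) :
  (exists u : U, u <> 0) -> artinian U -> uniserial U ->
  uniformly_nilpotent U -> covering (Add U).
Proof.
move=> U_neq0 U_artinian U_uniserial U_nil A.
have [X [f [f_gen f_cov]]] := cover_map U_neq0 U_artinian U_uniserial A U_nil.
exists (dsum X U), f; split; last exact: f_cov.
split.
  exists X, setT; split; last first.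
    by exists idfun; split=> //; apply/seteqP; split=> // d _; exists d.
  split; first exact: submoduleT.
  exists [set 0]; split; [exact: submodule0 | exact: setTI | move=> d].
  by exists d, 0; rewrite addr0.
move=> C' g [Z [N [Nsum [i [i_inj iN]]]]]; rewrite -iN in Nsum.
have [p pi] := summand_retraction i_inj Nsum.
have [h hP] := choice (fun z => f_gen (g \o p \o dinj z)).
exists (dlift h \o i) => c.
have : f \o dlift h =1 g \o p.
  by apply: dsum_ext => z u; rewrite /= dlift_dinj; exact: (hP z u).
by move=> /(_ (i c)) /= ->; rewrite pi.
Qed.

Theorem mainTheorem4 (R : pzRingType) (U : lmodType R^c)
    (U_neq0 : exists u : U, u <> 0)
    (U_artinian : artinian U) (U_uniserial : uniserial U)
    (alpha : Ord) (U_ : Ord -> set U) (U_chain : submodule_chain alpha U_)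
    (beta : Ord)
    (beta_min : is_ord_min (fun gamma => gamma <=o alpha /\
       exists f : {linear U -> U}, U_ gamma = ker f /\ ker f <> [set 0]) beta) :
  let a := alpha <=o beta *o ord_omega in
  let b := forall I : Type, locally_T_nilpotent (fun _ : I => U) in
  (a <-> b) /\ (a \/ b -> covering (Add U)).
Proof.
move=> a b.
have ab : a -> b.
  move=> /(uniformly_nilpotent_of_le U_uniserial U_chain beta_min) Unil I.
  exact: locally_T_nilpotent_of_uniform.
have ba : b -> a.
  move=> /(_ unit).
  exact: (le_of_locally_T_nilpotent U_artinian U_uniserial U_chain beta_min).
split=> // ab'; have /(uniformly_nilpotent_of_le U_uniserial U_chain beta_min) : a.
  by case: ab' => // /ba.
exact: covering_of_uniformly_nilpotent.
Qed.
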